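(* For every positive integer $d$ there exists a constant $c=c(d)>0$ such that the following holds for every positive integer $t$. If $G$ is the intersection graph of $n$ axis-parallel boxes in $\mathbb{R}^{d}$ and $G$ contains no copy of $K_{t,t}$, then $G$ has at most $c\,t\,n(\log n)^{2d+3}$ edges.
   Context: An axis-parallel box in $\mathbb{R}^d$ is a set of the form $[a_1,b_1]\times\cdots\times[a_d,b_d]$. The intersection graph of a family of sets has the sets as vertices, two of them adjacent if they intersect. ''Contains no copy of $K_{t,t}$'' means $G$ has no (not necessarily induced) subgraph isomorphic to the complete bipartite graph $K_{t,t}$. *)

(* Defs.v *)
From HB Require Import structures.
From mathcomp Require Import all_boot all_order all_algebra.
From mathcomp Require Import all_classical all_reals all_analysis.
Set Implicit Arguments.
Unset Strict Implicit.
Unset Printing Implicit Defensive.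
Import Order.TTheory GRing.Theory Num.Theory.
Local Open Scope classical_set_scope.
Local Open Scope ring_scope.

Record sgraph := SGraph {
  vertex :> finType;
  adj : rel vertex;
  adj_sym : symmetric adj;
  adj_irrefl : irreflexive adj
}.
Arguments adj {s} _ _.

Definition edges (G : sgraph) : {set {set G}} :=
  [set [set p.1; p.2]%SET | p : G * G & adj p.1 p.2]%SET.

(* A copy need not be induced: edges are preserved, not reflected. *)
Definition contains_copy (H G : sgraph) : Prop :=
  exists f : H -> G,
    injective f /\ (forall x y : H, adj x y -> adj (f x) (f y)).

Definition Kbip_adj (s t : nat) : rel ('I_s + 'I_t) := fun x y =>
  match x, y with
  | inl _, inr _ | inr _, inl _ => true
  | _, _ => false
  end.

Lemma Kbip_sym (s t : nat) : symmetric (@Kbip_adj s t).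
Proof. by move=> [?|?] [?|?]. Qed.

Lemma Kbip_irrefl (s t : nat) : irreflexive (@Kbip_adj s t).
Proof. by move=> [?|?]. Qed.

Definition Kbip (s t : nat) : sgraph :=
  SGraph (@Kbip_sym s t) (@Kbip_irrefl s t).

Section IntersectionGraph.
Variables (T : Type) (I : finType) (F : I -> set T).

Definition inter_adj : rel I := fun i j =>
  (i != j) && `[< F i `&` F j !=set0 >].

Lemma inter_sym : symmetric inter_adj.
Proof. by move=> i j; rewrite /inter_adj eq_sym setIC. Qed.

Lemma inter_irrefl : irreflexive inter_adj.
Proof. by move=> i; rewrite /inter_adj eqxx. Qed.

(* The family is indexed, so equal sets with different indices are distinct
   (and, when nonempty, adjacent) vertices. *)
Definition inter_graph : sgraph := SGraph inter_sym inter_irrefl.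

End IntersectionGraph.

(* Degenerate sides [a_i, a_i] are allowed; the empty set is not a box. *)
Definition axis_parallel_box (R : realType) (d : nat)
    (B : set 'rV[R]_d) : Prop :=
  exists a b : 'rV[R]_d,
    (forall k, a 0 k <= b 0 k) /\
    B = [set x : 'rV[R]_d | forall k, a 0 k <= x 0 k <= b 0 k].

(* Main.v *)
Require Import Defs.
From HB Require Import structures.
From mathcomp Require Import all_boot all_order all_algebra.
From mathcomp Require Import all_classical all_reals all_analysis.
From mathcomp Require Import zify ring.
Set Implicit Arguments.
Unset Strict Implicit.
Unset Printing Implicit Defensive.
Import Order.TTheory GRing.Theory Num.Theory.
Local Open Scope classical_set_scope.
Local Open Scope ring_scope.

(** Two boxes meet iff 2d inequalities [u x <= v y] hold, so the graph is a
    conjunction of 2d threshold relations. Order the values of one of them by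
    rank in [0, 2^m) and halve this range repeatedly: pairs with x in the lower
    and y in the upper half satisfy that inequality automatically, pairs with x
    upper and y lower violate it, and the other two kinds are treated
    recursively. Each inequality thus costs a factor m+1 = O(log n), and with no
    inequality left the graph is complete bipartite, where excluding K_{s,s}
    leaves at most s(|X|+|Y|) pairs. *)

(** * Counting pairs under conjunctions of threshold inequalities *)

Lemma subset_of_card (T : finType) (A : {set T}) k :
  (k <= #|A|)%N -> exists2 B : {set T}, B \subset A & #|B| = k.
Proof.
rewrite -bin_gt0 -cards_draws => /card_gt0P[B].
by rewrite inE => /andP[sBA /eqP cB]; exists B.
Qed.

Section Threshold.
Variables S T : finType.
Implicit Types (P : S -> T -> bool) (X : {set S}) (Y : {set T}).

Definition biclique_free (s : nat) P X Y : Prop :=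
  forall (A : {set S}) (B : {set T}), A \subset X -> B \subset Y ->
    #|A| = s -> #|B| = s -> exists x y, [/\ x \in A, y \in B & ~~ P x y].

Definition npairs P X Y : nat := (\sum_(x in X) \sum_(y in Y) P x y)%N.

(** Quantified over all [X] and [Y], so that the bound can be applied to the blocks cut out by the
    halving. *)
Definition linear_npairs (s C : nat) P : Prop :=
  forall X Y, biclique_free s P X Y -> (npairs P X Y <= C * (#|X| + #|Y|))%N.

Lemma biclique_free_sub s P X Y X' Y' : X' \subset X -> Y' \subset Y ->
  biclique_free s P X Y -> biclique_free s P X' Y'.
Proof.
move=> sX sY free A B sA sB.
by apply: free; [exact: fintype.subset_trans sX|exact: fintype.subset_trans sY].
Qed.

Lemma biclique_free_eq s P Q X Y :
  {in X & Y, forall x y, P x y = Q x y} ->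
  biclique_free s P X Y -> biclique_free s Q X Y.
Proof.
move=> PQ free A B sA sB cA cB.
have [x [y [xA yB nP]]] := free A B sA sB cA cB.
exists x, y; split=> //.
by rewrite -PQ ?(fintype.subsetP sA) ?(fintype.subsetP sB).
Qed.

Lemma npairs_eq P Q X Y :
  {in X & Y, forall x y, P x y = Q x y} -> npairs P X Y = npairs Q X Y.
Proof.
by move=> PQ; apply: eq_bigr => x xX; apply: eq_bigr => y yY; rewrite PQ.
Qed.

Lemma leq_npairs P X Y : (npairs P X Y <= #|X| * #|Y|)%N.
Proof.
rewrite /npairs -sum_nat_const; apply: leq_sum => x _.
by rewrite -sum1_card; apply: leq_sum => y _; case: P.
Qed.

Lemma npairs_splitl P X Y (D : {set S}) :
  npairs P X Y = (npairs P (X :&: D) Y + npairs P (X :\: D) Y)%N.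
Proof. exact: big_setID. Qed.

Lemma npairs_splitr P X Y (D : {set T}) :
  npairs P X Y = (npairs P X (Y :&: D) + npairs P X (Y :\: D))%N.
Proof.
by rewrite /npairs -big_split; apply: eq_bigr => x _; exact: big_setID.
Qed.

(** If both sides had at least [s] elements, any two [s]-subsets would form a biclique; so one side
    is smaller than [s], and the product of the sizes is at most [s] times the other. *)
Lemma linear_npairsT s : linear_npairs s s (fun _ _ => true).
Proof.
move=> X Y free; apply: leq_trans (leq_npairs _ _ _) _.
have [ltX|leX] := ltnP #|X| s; first by nia.
have [ltY|leY] := ltnP #|Y| s; first by nia.
have [A sA cA] := subset_of_card leX; have [B sB cB] := subset_of_card leY.
by have [x [y []]] := free A B sA sB cA cB.
Qed.

Section Halving.
Variables (s C : nat) (P : S -> T -> bool) (f : S -> nat) (g : T -> nat).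
Let Q x y := (f x <= g y)%N && P x y.

Lemma npairs_halving e lo X Y : linear_npairs s C P ->
  {in X, forall x, (lo <= f x < lo + 2 ^ e)%N} ->
  {in Y, forall y, (lo <= g y < lo + 2 ^ e)%N} ->
  biclique_free s Q X Y -> (npairs Q X Y <= C * e.+1 * (#|X| + #|Y|))%N.
Proof.
move=> linP; elim: e lo X Y => [|e IHe] lo X Y hX hY free.
  (* The range is the single value [lo], so the threshold always holds. *)
  have QP : {in X & Y, forall x y, Q x y = P x y}.
    move=> x y /hX hx /hY hy; rewrite /Q.
    by have -> : (f x <= g y)%N by lia.
  by rewrite (npairs_eq QP) muln1; apply: linP; exact: biclique_free_eq free.
pose mid := (lo + 2 ^ e)%N.
pose L := [set x | (f x < mid)%N]%SET; pose M := [set y | (g y < mid)%N]%SET.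
have E2 : (2 ^ e.+1 = 2 ^ e + 2 ^ e)%N by rewrite expnS mul2n addnn.
rewrite (npairs_splitl _ _ _ L).
rewrite (npairs_splitr _ (X :&: L) _ M) (npairs_splitr _ (X :\: L) _ M).
have sXL : X :&: L \subset X by exact: finset.subsetIl.
have sXU : X :\: L \subset X by exact: finset.subsetDl.
have sYL : Y :&: M \subset Y by exact: finset.subsetIl.
have sYU : Y :\: M \subset Y by exact: finset.subsetDl.
have LL : (npairs Q (X :&: L) (Y :&: M) <=
    C * e.+1 * (#|X :&: L| + #|Y :&: M|))%N.
  apply: (IHe lo); last exact: biclique_free_sub free.
    by move=> x; rewrite !inE => /andP[/hX]; rewrite /mid; lia.
  by move=> y; rewrite !inE => /andP[/hY]; rewrite /mid; lia.
have UU : (npairs Q (X :\: L) (Y :\: M) <=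
    C * e.+1 * (#|X :\: L| + #|Y :\: M|))%N.
  apply: (IHe mid); last exact: biclique_free_sub free.
    by move=> x; rewrite !inE => /andP[+ /hX]; rewrite /mid; lia.
  by move=> y; rewrite !inE => /andP[+ /hY]; rewrite /mid; lia.
have UL : npairs Q (X :\: L) (Y :&: M) = 0%N.
  rewrite /npairs big1 // => x; rewrite !inE => /andP[ux _].
  rewrite big1 // => y; rewrite !inE => /andP[_ ly].
  by rewrite /Q; have -> : (f x <= g y)%N = false by lia.
(* On this block [Q] agrees with [P], so it costs only [C] per element: this is the extra [C] that
   each level of the recursion adds. *)
have LU : (npairs Q (X :&: L) (Y :\: M) <=
    C * (#|X :&: L| + #|Y :\: M|))%N.
  have QP : {in X :&: L & Y :\: M, forall x y, Q x y = P x y}.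
    move=> x y; rewrite !inE => /andP[_ lx] /andP[uy _]; rewrite /Q.
    by have -> : (f x <= g y)%N by lia.
  rewrite (npairs_eq QP); apply: linP; apply: biclique_free_eq QP _.
  exact: biclique_free_sub free.
rewrite UL -(cardsID L X) -(cardsID M Y).
move: LL UU LU; move: (npairs _ _ _) (npairs _ _ _) (npairs _ _ _).
by move: #|_| #|_| #|_| #|_| => a b c d p q r; nia.
Qed.

End Halving.

Lemma linear_npairs_threshold disp (R : orderType disp)
    (u : S -> R) (v : T -> R) s C m P :
  (#|S| < 2 ^ m)%N -> linear_npairs s C P ->
  linear_npairs s (C * m.+1) (fun x y => (u x <= v y)%O && P x y).
Proof.
move=> hm linP X Y.
(* Counting values of [u] alone suffices: if [v y < u x], then [x] itself is counted in the rank of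
   [u x] but not in that of [v y]. *)
pose rk r := #|[set z | (u z <= r)%O]%SET|.
have rk_lt r : (0 <= rk r < 0 + 2 ^ m)%N.
  by rewrite leq0n add0n; apply: leq_ltn_trans hm; exact: max_card.
have rkE x y : (u x <= v y)%O = (rk (u x) <= rk (v y))%N.
  apply/idP/idP => [le_uv|].
    apply/subset_leq_card/fintype.subsetP => z.
    by rewrite !inE => /le_trans; exact.
  apply: contraTT; rewrite -ltNge -ltnNge => lt_vu.
  apply: proper_card; apply/properP; split.
    by apply/fintype.subsetP => z; rewrite !inE => /le_trans; apply; exact: ltW.
  by exists x; rewrite !inE ?lexx // -ltNge.
have E : {in X & Y, forall x y, (u x <= v y)%O && P x y =
    (rk (u x) <= rk (v y))%N && P x y} by move=> x y _ _; rewrite rkE.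
rewrite (npairs_eq E) => /(biclique_free_eq E) free.
apply: (npairs_halving (f := rk \o u) (g := rk \o v) linP _ _ free) => z _;
  exact: rk_lt.
Qed.

Lemma linear_npairs_all disp (R : orderType disp)
    (cs : seq ((S -> R) * (T -> R))) s m : (#|S| < 2 ^ m)%N ->
  linear_npairs s (s * m.+1 ^ size cs)
    (fun x y => all (fun c => (c.1 x <= c.2 y)%O) cs).
Proof.
move=> hm; elim: cs => [|c cs IHcs] /=.
  by rewrite expn0 muln1; exact: linear_npairsT.
by rewrite expnSr mulnA; exact: linear_npairs_threshold.
Qed.

End Threshold.

(** * From intersecting boxes to threshold inequalities *)

Lemma box_meet (R : realType) (d : nat) (a b a' b' : 'rV[R]_d) :
  (forall k, a 0 k <= b 0 k) -> (forall k, a' 0 k <= b' 0 k) ->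
  ([set x : 'rV[R]_d | forall k, a 0 k <= x 0 k <= b 0 k] `&`
   [set x : 'rV[R]_d | forall k, a' 0 k <= x 0 k <= b' 0 k] !=set0) <->
  (forall k, (a 0 k <= b' 0 k) /\ (a' 0 k <= b 0 k)).
Proof.
move=> ab ab'; split=> [[x [/= hx hx']] k|h].
  have /andP[? ?] := hx k; have /andP[? ?] := hx' k.
  by split; [apply: (@le_trans _ _ (x 0 k))|apply: (@le_trans _ _ (x 0 k))].
exists (\row_k Num.max (a 0 k) (a' 0 k)).
split=> k /=; rewrite mxE le_max ge_max.
  by rewrite lexx ab (h k).2.
by rewrite lexx orbT ab' (h k).1.
Qed.

Lemma Kbip_copy (G : sgraph) (t : nat) (A B : {set G}) :
  (t <= #|A|)%N -> (t <= #|B|)%N -> {in A & B, forall x y, adj x y} ->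
  contains_copy (Kbip t t) G.
Proof.
move=> leA leB AB.
pose fa (i : 'I_t) := enum_val (widen_ord leA i).
pose fb (i : 'I_t) := enum_val (widen_ord leB i).
have adj_ab i j : adj (fa i) (fb j) by apply: AB; exact: enum_valP.
exists (fun z => match z with inl i => fa i | inr j => fb j end).
split=> [|[i|i] [j|j] //= _]; last by rewrite adj_sym.
move=> [i|i] [j|j] eq_ij.
- by congr inl; apply: val_inj; have /(congr1 val) := enum_val_inj eq_ij.
(* A vertex common to both sides would be adjacent to itself. *)
- by have := adj_ab i j; rewrite eq_ij adj_irrefl.
- by have := adj_ab j i; rewrite eq_ij adj_irrefl.
- by congr inr; apply: val_inj; have /(congr1 val) := enum_val_inj eq_ij.
Qed.

(** The edge set is an image of the set of adjacent ordered pairs, all of which [P] counts. *)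
Lemma leq_edges_npairs (G : sgraph) (P : G -> G -> bool) :
  (forall x y, adj x y -> P x y) ->
  (#|edges G| <= npairs P [set: _]%SET [set: _]%SET)%N.
Proof.
move=> adjP; apply: leq_trans (leq_imset_card _ _) _.
rewrite -sum1_card /npairs pair_big_dep /= big_mkcond [leqRHS]big_mkcond /=.
apply: leq_sum => -[x y] _; rewrite !finset.in_setT inE /=.
by case: ifP => // /adjP ->.
Qed.

Lemma edges_Kbip_free_box (R : realType) (d n t m : nat)
    (B : 'I_n -> set 'rV[R]_d) : (n < 2 ^ m)%N ->
  (forall i, axis_parallel_box (B i)) ->
  ~ contains_copy (Kbip t t) (inter_graph B) ->
  (#|edges (inter_graph B)| <= 4 * t * n * m.+1 ^ (2 * d))%N.
Proof.
move=> hm boxB noK.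
have /choice[ab hab] : forall i, exists p : 'rV[R]_d * 'rV[R]_d,
    (forall k, p.1 0 k <= p.2 0 k) /\
    B i = [set x : 'rV[R]_d | forall k, p.1 0 k <= x 0 k <= p.2 0 k].
  by move=> i; have [a [b h]] := boxB i; exists (a, b).
(* Negation turns the inequality between the lower corner of [j] and the upper corner of [i] around,
   so that [i] is on the left in both families. *)
pose cs := [seq (fun i => (ab i).1 0 k, fun j => (ab j).2 0 k) | k <- ord_enum d]
  ++ [seq (fun i => - (ab i).2 0 k, fun j => - (ab j).1 0 k) | k <- ord_enum d].
have size_cs : size cs = (2 * d)%N.
  have size_d : size (ord_enum d) = d.
    by rewrite -(size_map val) val_ord_enum size_iota.
  by rewrite size_cat !size_map size_d mul2n addnn.
pose P i j := all (fun c => (c.1 i <= c.2 j)%O) cs.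
have meetP i j : (B i `&` B j !=set0) <-> P i j.
  have [abi ->] := hab i; have [abj ->] := hab j.
  rewrite (box_meet abi abj) /P /cs all_cat !all_map.
  split=> [h|/andP[/allP h1 /allP h2] k].
    by apply/andP; split; apply/allP => k _ /=; rewrite ?lerN2; have [] := h k.
  have := h1 k (mem_ord_enum k); have := h2 k (mem_ord_enum k).
  by rewrite /= lerN2.
(* A vertex may lie on both sides of a biclique of P; with sides of size 2t one
   can still extract disjoint sides of size t. *)
have free : biclique_free (2 * t) P [set: _]%SET [set: _]%SET.
  move=> A0 C _ _ cA0 cC; apply: contrapT => allP'.
  have PAC x y : x \in A0 -> y \in C -> P x y.
    by move=> xA yC; apply: contrapT => /negP nP; apply: allP'; exists x, y.
  have [|A sA cA] := @subset_of_card _ A0 t; first by lia.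
  have leC : (t <= #|C :\: A|)%N.
    have := cardsID A C; have := subset_leq_card (finset.subsetIr C A); lia.
  apply: noK; apply: (@Kbip_copy (inter_graph B) t A (C :\: A)) => //.
    by rewrite cA.
  move=> x y xA; rewrite !inE => /andP[yA yC] /=; rewrite /inter_adj.
  apply/andP; split; first by apply: contraNneq yA => <-.
  by apply/asboolP/meetP/PAC => //; exact: (fintype.subsetP sA).
have hm' : (#|'I_n| < 2 ^ m)%N by rewrite card_ord.
have := linear_npairs_all hm' free; rewrite size_cs !cardsT card_ord => le_np.
have le_e : (#|edges (inter_graph B)| <= npairs P [set: _]%SET [set: _]%SET)%N.
  by apply: leq_edges_npairs => x y /andP[_ /asboolP/meetP].
(* The 4 is the 2 of [2 * t] times the 2 of [n + n]. *)
apply: leq_trans le_e _; apply: leq_trans le_np _; nia.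
Qed.

(** * Passing to the natural logarithm *)

Lemma trunc_log2_le_ln (R : realType) (n : nat) : (1 < n)%N ->
  (trunc_log 2 n).+2%:R <= 3 / ln 2 * ln (n%:R : R).
Proof.
move=> n1; have ln2 : 0 < ln (2 : R) by rewrite ln_gt0 // ltr1n.
have n0 : (0 < n)%N by exact: ltnW.
set k := trunc_log 2 n.
(* Since [k] is at least 1, [k + 2 <= 3 * k], whence the factor 3. *)
have k1 : (0 < k)%N by rewrite trunc_log_gt0.
have k_ln : k%:R * ln 2 <= ln (n%:R : R).
  rewrite mulr_natl -lnXn // -natrX ler_ln ?posrE ?ltr0n ?expn_gt0 //.
  by rewrite ler_nat; exact: trunc_logP.
rewrite mulrAC ler_pdivlMr //; apply: le_trans (ler_wpM2l _ k_ln) => //.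
by rewrite mulrA ler_wpM2r ?(ltW ln2) // -natrM ler_nat; lia.
Qed.

Theorem theorem1 (R : realType) (d : nat) (hd : (0 < d)%N) :
  exists c : R, 0 < c /\
    forall t : nat, (0 < t)%N ->
    forall (n : nat) (B : 'I_n -> set 'rV[R]_d),
      (forall i : 'I_n, axis_parallel_box (B i)) ->
      ~ contains_copy (Kbip t t) (inter_graph B) ->
      #|edges (inter_graph B)|%:R
        <= c * t%:R * n%:R * ln (n%:R : R) ^+ (2 * d + 3).
Proof.
have ln2 : 0 < ln (2 : R) by rewrite ln_gt0 // ltr1n.
(* The 4 comes from [edges_Kbip_free_box]; each of the [2 * d + 3] factors [k] below costs
   [3 / ln 2] against [ln n]. *)
exists (4 * (3 / ln 2) ^+ (2 * d + 3)); split.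
  by rewrite mulr_gt0 // exprn_gt0 // divr_gt0.
move=> t t0 n B boxB noK.
have [n1|n1] := leqP n 1.
  have -> : #|edges (inter_graph B)| = 0%N.
    have le0 : (#|edges (inter_graph B)| <=
        npairs (fun _ _ : 'I_n => false) [set: _]%SET [set: _]%SET)%N.
      apply: leq_edges_npairs => x y /andP[/eqP[]]; apply: val_inj => /=.
      by have := ltn_ord x; have := ltn_ord y; lia.
    apply/eqP; rewrite -leqn0 (leq_trans le0) // /npairs big1 // => x _.
    by rewrite big1.
  (* For [n = 0] this is the default value of [ln] at 0. *)
  have ln0 : ln (n%:R : R) = 0.
    by case: n n1 {B boxB noK} => [|[|]] // _; rewrite ?ln1 ?ln0.
  by rewrite ln0 expr0n addn3 mulr0.
set k := (trunc_log 2 n).+2.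
have nk : (n < 2 ^ (trunc_log 2 n).+1)%N by exact: trunc_log_ltn.
have := edges_Kbip_free_box nk boxB noK; rewrite -/k => le_e.
(* The exponent [2 * d] may be raised because [k] is positive. *)
have le_e' : (#|edges (inter_graph B)| <= 4 * t * n * k ^ (2 * d + 3))%N.
  by apply: leq_trans le_e _; rewrite leq_mul2l leq_pexp2l ?leq_addr ?orbT.
apply: (@le_trans _ _ (4 * t * n * k ^ (2 * d + 3))%:R).
  by rewrite ler_nat.
rewrite !natrM natrX.
have -> (c x y z e : R) : c * e * x * y * z = c * x * y * (e * z) by ring.
rewrite -exprMn ler_wpM2l // ?mulr_ge0 // lerXn2r ?nnegrE ?trunc_log2_le_ln //.
by apply: le_trans (trunc_log2_le_ln _ n1).
Qed.
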